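(* Let $n\ge 1$, $k=2^n-1$, and $\mathbf{b}\in\mathbb{R}^k$. The inequality $\mathbf{b}^{\top}\mathbf{s}\ge 0$ is von-Neumann-type if and only if $$\min_{\mathbf{s}\in\mathbb{R}^{k}}\ \mathbf{b}^{\top}\mathbf{s}\quad\text{subject to}\quad \mathbf{G}\mathbf{s}\ge \mathbf{0}$$ is zero.
   Context: Let $N_n=\{1,\dots,n\}$ and $k=2^n-1$. The entropic space is $\mathbb{R}^k$, with coordinates indexed by the nonempty subsets $I\subseteq N_n$; the coordinate of $\mathbf{s}$ at $I$ is written $S(I)$, and $S(\emptyset)=0$ by convention. (For an $n$-party quantum state, $S(I)$ stands for the von Neumann entropy of the marginal on the parties in $I$.) Vector inequalities are componentwise. The basic inequalities are all instances, for nonempty $I,J\subseteq N_n$, of strong sub-additivity $S(I)+S(J)\ge S(I\cup J)+S(I\cap J)$ and weak monotonicity $S(I)+S(J)\ge S(I\setminus J)+S(J\setminus I)$. The von-Neumann cone $\Gamma_n\subset\mathbb{R}^k$ is the set of all $\mathbf{s}\in\mathbb{R}^k$ satisfying all basic inequalities. The elemental inequalities are: (i) $S(I)+S(J)-S(I\cup J)-S(I\cap J)\ge 0$ for $I,J\subseteq N_n$ with $I\setminus J=\{i\}$, $J\setminus I=\{j\}$ and $j>i$; (ii) $S(I)+S(J)-S(I\setminus J)-S(J\setminus I)\ge 0$ for $I,J\subseteq N_n$ with $I\cap J=\{l\}$, $I\cup J=N_n$ and $l+1\in I$ (where $l+1$ is read cyclically, i.e. $n+1$ means $1$). $\mathbf{G}$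 is the real coefficient matrix with $k$ columns whose rows are the coefficient vectors of the elemental inequalities, so that these inequalities read $\mathbf{G}\mathbf{s}\ge\mathbf{0}$. By a known result of Pippenger, the elemental inequalities generate all basic inequalities, so $\Gamma_n=\{\mathbf{s}\in\mathbb{R}^k:\mathbf{G}\mathbf{s}\ge\mathbf{0}\}$. The inequality $\mathbf{b}^{\top}\mathbf{s}\ge 0$ is called von-Neumann-type if $\Gamma_n\subset\{\mathbf{s}\in\mathbb{R}^k:\mathbf{b}^{\top}\mathbf{s}\ge 0\}$. *)

(* Defs.v *)
From HB Require Import structures.
From mathcomp Require Import all_boot all_order all_algebra.
From mathcomp Require Import boolp classical_sets reals.

Set Implicit Arguments.
Unset Strict Implicit.
Unset Printing Implicit Defensive.

Import Order.TTheory GRing.Theory Num.Theory.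

Local Open Scope set_scope.
Local Open Scope ring_scope.

(* The parties 1, ..., n are the elements 0, ..., n - 1 of 'I_n. *)

Section EntropicSpace.
Variable n : nat.

Definition nonempty_subsets : {set {set 'I_n}} := [set I | I != finset.set0].

Definition edim : nat := (2 ^ n - 1)%N.

Lemma card_nonempty_subsets : #|nonempty_subsets| = edim.
Proof.
have -> : nonempty_subsets = [set~ finset.set0].
  by apply/finset.setP => I; rewrite !inE.
by rewrite cardsC1 -cardsT -finset.powersetT card_powerset cardsT card_ord /edim subn1.
Qed.

(* The nonempty subset labelling a coordinate; any fixed enumeration would do. *)
Definition label (c : 'I_edim) : {set 'I_n} :=
  enum_val (cast_ord (esym card_nonempty_subsets) c).

Lemma label_neq0 (c : 'I_edim) : label c != finset.set0.
Proof. by have := enum_valP (cast_ord (esym card_nonempty_subsets) c); rewrite inE. Qed.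

Lemma label_inj : injective label.
Proof. by move=> c d /enum_val_inj /cast_ord_inj. Qed.

Lemma label_surj (I : {set 'I_n}) : I != finset.set0 -> exists c, label c = I.
Proof.
move=> I0; have Ii : I \in nonempty_subsets by rewrite inE.
exists (cast_ord card_nonempty_subsets (enum_rank_in Ii I)).
by rewrite /label cast_ordK enum_rankK_in.
Qed.

Variable R : realType.

(* ent s I is the coordinate of s labelled by I, and 0 when I is empty since no
   coordinate is labelled by the empty set (see ent_label, ent_set0). *)
Definition ent (s : 'cV[R]_edim) (I : {set 'I_n}) : R :=
  \sum_(c < edim | label c == I) s c 0.

Lemma ent_label (s : 'cV[R]_edim) (c : 'I_edim) : ent s (label c) = s c 0.
Proof.
by rewrite /ent (eq_bigl (pred1 c)) ?big_pred1_eq // => d; rewrite /= (inj_eq label_inj).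
Qed.

Lemma ent_set0 (s : 'cV[R]_edim) : ent s finset.set0 = 0.
Proof. by rewrite /ent big1 // => c /eqP c0; have := label_neq0 c; rewrite c0 eqxx. Qed.

Definition strong_subadditivity (s : 'cV[R]_edim) (I J : {set 'I_n}) : Prop :=
  ent s I + ent s J >= ent s (I :|: J) + ent s (I :&: J).

Definition weak_monotonicity (s : 'cV[R]_edim) (I J : {set 'I_n}) : Prop :=
  ent s I + ent s J >= ent s (I :\: J) + ent s (J :\: I).

Definition von_Neumann_cone : set 'cV[R]_edim :=
  [set s | forall I J : {set 'I_n}, I != finset.set0 -> J != finset.set0 ->
     strong_subadditivity s I J /\ weak_monotonicity s I J]%classic.

Definition elemental1 : {set {set 'I_n} * {set 'I_n}} :=
  [set IJ | [exists i : 'I_n, exists j : 'I_n,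
    [&& IJ.1 :\: IJ.2 == [set i], IJ.2 :\: IJ.1 == [set j]
      & (i < j)%N]]].

(* ordS l is the cyclic successor of l in 'I_n. *)
Definition elemental2 : {set {set 'I_n} * {set 'I_n}} :=
  [set IJ | [exists l : 'I_n,
    [&& IJ.1 :&: IJ.2 == [set l], IJ.1 :|: IJ.2 == [set: 'I_n]
      & ordS l \in IJ.1]]].

(* The coefficient vector of the linear form s |-> ent s I (see coef_vecE). *)
Definition coef_vec (I : {set 'I_n}) : 'rV[R]_edim :=
  \row_(c < edim) (label c == I)%:R.

Lemma coef_vecE (I : {set 'I_n}) (s : 'cV[R]_edim) : (coef_vec I *m s) 0 0 = ent s I.
Proof.
rewrite mxE /ent [RHS]big_mkcond; apply: eq_bigr => c _.
by rewrite mxE; case: eqP; rewrite ?mul1r ?mul0r.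
Qed.

Definition elemental1_row (I J : {set 'I_n}) : 'rV[R]_edim :=
  coef_vec I + coef_vec J - coef_vec (I :|: J) - coef_vec (I :&: J).

Definition elemental2_row (I J : {set 'I_n}) : 'rV[R]_edim :=
  coef_vec I + coef_vec J - coef_vec (I :\: J) - coef_vec (J :\: I).

Definition G1 : 'M[R]_(#|elemental1|, edim) :=
  \matrix_(r < #|elemental1|) elemental1_row (enum_val r).1 (enum_val r).2.

Definition G2 : 'M[R]_(#|elemental2|, edim) :=
  \matrix_(r < #|elemental2|) elemental2_row (enum_val r).1 (enum_val r).2.

Definition G : 'M[R]_(#|elemental1| + #|elemental2|, edim) := col_mx G1 G2.

Definition inner (b s : 'cV[R]_edim) : R := (b^T *m s) 0 0.

Definition von_Neumann_type (b : 'cV[R]_edim) : Prop :=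
  (von_Neumann_cone `<=` [set s | 0 <= inner b s])%classic.

End EntropicSpace.

Definition lemx (R : realType) (m p : nat) (A B : 'M[R]_(m, p)) : Prop :=
  forall i j, A i j <= B i j.

(* v is the minimum of E; in particular it is attained. *)
Definition is_min (R : realType) (E : set R) (v : R) : Prop :=
  E v /\ lbound E v.

(* G s >= 0 reads as the list of elemental inequalities. *)
Lemma mulG_ge0 (n : nat) (R : realType) (s : 'cV[R]_(edim n)) :
  lemx 0 (G n R *m s) <->
  (forall I J, (I, J) \in elemental1 n ->
     0 <= ent s I + ent s J - ent s (I :|: J) - ent s (I :&: J)) /\
  (forall I J, (I, J) \in elemental2 n ->
     0 <= ent s I + ent s J - ent s (I :\: J) - ent s (J :\: I)).
Proof.
have r1 I J : (elemental1_row R I J *m s) 0 0 =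
    ent s I + ent s J - ent s (I :|: J) - ent s (I :&: J).
  by rewrite !mulmxDl !mulNmx -!coef_vecE !mxE.
have r2 I J : (elemental2_row R I J *m s) 0 0 =
    ent s I + ent s J - ent s (I :\: J) - ent s (J :\: I).
  by rewrite !mulmxDl !mulNmx -!coef_vecE !mxE.
have e1 r : (G1 n R *m s) r 0 =
    (elemental1_row R (enum_val r).1 (enum_val r).2 *m s) 0 0.
  by rewrite !mxE; apply: eq_bigr => c _; rewrite !mxE.
have e2 r : (G2 n R *m s) r 0 =
    (elemental2_row R (enum_val r).1 (enum_val r).2 *m s) 0 0.
  by rewrite !mxE; apply: eq_bigr => c _; rewrite !mxE.
rewrite /lemx /G mul_col_mx; split=> [Gs | [h1 h2] r c].
  split=> I J IJ.
    have := Gs (lshift _ (enum_rank_in IJ (I, J))) 0.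
    by rewrite col_mxEu e1 enum_rankK_in // r1 mxE.
  have := Gs (rshift _ (enum_rank_in IJ (I, J))) 0.
  by rewrite col_mxEd e2 enum_rankK_in // r2 mxE.
rewrite (ord1 c) [leLHS]mxE; case: (split_ordP r) => k ->.
  by rewrite col_mxEu e1 r1; apply: h1; rewrite -surjective_pairing; exact: enum_valP.
by rewrite col_mxEd e2 r2; apply: h2; rewrite -surjective_pairing; exact: enum_valP.
Qed.

(* Main.v *)
Require Import Defs.
From HB Require Import structures.
From mathcomp Require Import all_boot all_order all_algebra.
From mathcomp Require Import boolp classical_sets reals.
From mathcomp Require Import lra.

Set Implicit Arguments.
Unset Strict Implicit.
Unset Printing Implicit Defensive.

Import Order.TTheory GRing.Theory Num.Theory.

Local Open Scope set_scope.
Local Open Scope ring_scope.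

(** The content is Pippenger's theorem that the elemental inequalities imply the
    basic ones; zero is then attained at [s = 0].  Local submodularity
    [f(K i) + f(K j) >= f(K i j) + f(K)] telescopes to submodularity.  For
    disjoint [A], [B] avoiding [l], with [D] the remaining parties, the elemental
    inequality [f(A l) + f(B D l) >= f(A) + f(B D)] and submodularity
    [f(B l) + f(B D) >= f(B D l) + f(B)] add up to weak monotonicity with
    one-point intersection.  An intersection [C l] is reduced to [C] by adding
    [f(A C l) + f(B l) >= f(A C) + f(B)] and [f(A C) + f(B l C) >= f(A) + f(B l)]. *)

Section SetFunctions.
Variables (T : finType) (R : realDomainType) (f : {set T} -> R).

Lemma finset_ind (P : {set T} -> Prop) :
  P finset.set0 -> (forall (i : T) (X : {set T}), i \notin X -> P X -> P (i |: X)) ->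
  forall X, P X.
Proof.
move=> P0 PU X; have [m] := ubnP #|X|; elim: m X => // m IHm X.
have [->|[i iX]] := finset.set_0Vmem X; first by [].
rewrite (cardsD1 i) iX ltnS add1n => cX.
rewrite -(finset.setD1K iX); apply: PU; last exact: IHm.
by rewrite !inE eqxx.
Qed.

Lemma disjointsU (A B C : {set T}) :
  [disjoint A :|: B & C] = [disjoint A & C] && [disjoint B & C].
Proof. by rewrite -!finset.setI_eq0 finset.setIUl finset.setU_eq0. Qed.

Definition locally_submodular := forall (K : {set T}) i j,
  i \notin K -> j \notin K -> i != j ->
  f (i |: (j |: K)) + f K <= f (i |: K) + f (j |: K).

Definition submodular := forall I J : {set T},
  f (I :|: J) + f (I :&: J) <= f I + f J.

(** The gain from adding [i] can only shrink as the base grows from [K] to [X :|: K]: each element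
    of [X] new to the base contributes one local inequality. *)
Lemma locally_submodular_marginal (K X : {set T}) i :
  locally_submodular -> i \notin K -> i \notin X ->
  f (i |: (X :|: K)) + f K <= f (i |: K) + f (X :|: K).
Proof.
move=> fK iK; elim/finset_ind: X => [_|j X jX IH]; first by rewrite finset.set0U.
rewrite !inE negb_or => /andP[ij iX]; have {IH} := IH iX.
rewrite -finset.setUA; have [jK|jK] := boolP (j \in K).
  by rewrite (finset.setUidPr (_ : [set j] \subset X :|: K)) // finset.sub1set inE jK orbT.
have := fK (X :|: K) i j; rewrite !inE !negb_or iX iK jX jK.
by move=> /(_ isT isT ij); lra.
Qed.

Lemma locally_submodular_submodular : locally_submodular -> submodular.
Proof.
(* With base [K = I :&: J] and the two differences as [X] and [Y], induction on [X] needs one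
   marginal inequality per element. *)
move=> fK; suff fXY (K X Y : {set T}) : [disjoint X & Y] ->
    f (X :|: (Y :|: K)) + f K <= f (X :|: K) + f (Y :|: K).
  move=> I J; have := fXY (I :&: J) (I :\: J) (J :\: I).
  have -> : I :\: J :|: (J :\: I :|: I :&: J) = I :|: J.
    by apply/finset.setP => x; rewrite !inE; do 2![case: (x \in _)].
  have -> : I :\: J :|: I :&: J = I by rewrite finset.setUC finset.setID.
  have -> : J :\: I :|: I :&: J = J.
    by rewrite finset.setUC finset.setIC finset.setID.
  apply; apply/pred0P => x /=; rewrite !inE.
  by do 2![case: (x \in _)].
elim/finset_ind: X => [_|i X iX IH dXY].
  by rewrite !finset.set0U addrC.
have iY : i \notin Y by rewrite (disjointFr dXY) // !inE eqxx.
have dX : [disjoint X & Y] by apply: disjointWl dXY; apply: finset.subsetUr.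
have {IH} := IH dX; rewrite -!finset.setUA; have [iK|iK] := boolP (i \in K).
  by rewrite !(finset.setUidPr (_ : [set i] \subset _)) // finset.sub1set !inE iK !orbT.
(* The gain of [i] over [X :|: K] is at least its gain once [Y] is added to that base. *)
have := @locally_submodular_marginal (X :|: K) Y i fK; rewrite !inE !negb_or iX iK.
by rewrite (finset.setUCA Y) => /(_ isT iY); lra.
Qed.

(** The second elemental family with [I = l |: A] and [J = l |: B], freed of its cyclic condition,
    since [T] carries no successor. *)
Definition pure_weakly_monotone := forall (A B : {set T}) l,
  l \notin A -> l \notin B -> [disjoint A & B] ->
  (l |: (A :|: B)) = [set: T] ->
  f A + f B <= f (l |: A) + f (l |: B).

Lemma weakly_monotone1 (A B : {set T}) l :
  submodular -> pure_weakly_monotone ->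
  l \notin A -> l \notin B -> [disjoint A & B] ->
  f A + f B <= f (l |: A) + f (l |: B).
Proof.
(* [E] is the union of [B] and the remaining parties, so [l], [A] and [E] partition [T], while
   [l |: B] and [E] meet in [B]. *)
move=> fS fW lA lB dAB; pose E := ~: (l |: A).
have lE : l \notin E by rewrite !inE eqxx.
have BE : B \subset E.
  apply/fintype.subsetP => x xB; rewrite !inE negb_or (disjointFl dAB xB) andbT.
  by apply: contraNneq lB => <-.
have := fW A E l lA lE; have := fS (l |: B) E.
rewrite -finset.setUA (finset.setUidPr BE).
have -> : (l |: B) :&: E = B.
  rewrite finset.setIUl (finset.setIidPl BE).
  by rewrite (_ : [set l] :&: E = finset.set0) ?finset.set0U //; apply/eqP; rewrite finset.setI_eq0 finset.disjoints1.
have dAE : [disjoint A & E].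
  by apply/pred0P => x /=; rewrite !inE; case: (x \in A); rewrite ?orbT ?andbF.
have AE : l |: (A :|: E) = [set: T] by rewrite finset.setUA finset.setUCr.
by move=> + /(_ dAE AE); lra.
Qed.

Lemma weakly_monotone (I J : {set T}) :
  submodular -> pure_weakly_monotone ->
  f (I :\: J) + f (J :\: I) <= f I + f J.
Proof.
move=> fS fW.
suff fABC (C A B : {set T}) : [disjoint A & B] -> [disjoint C & A] ->
    [disjoint C & B] -> f A + f B <= f (C :|: A) + f (C :|: B).
  have := fABC (I :&: J) (I :\: J) (J :\: I).
  rewrite finset.setID (finset.setIC I) finset.setID.
  by apply; apply/pred0P => x /=; rewrite !inE; do 2![case: (x \in _)].
elim/finset_ind: C A B => [A B _ _ _|l C lC IH A B dAB]; first by rewrite !finset.set0U.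
rewrite !(disjointsU, finset.disjoints1) => /andP[lA dCA] /andP[lB dCB].
(* The point [l] leaves the intersection and joins [B], hence the induction over general [A] and
   [B]. The terms at [C :|: A] and [l |: B] cancel in the sum. *)
have := IH A (l |: B); have := @weakly_monotone1 (C :|: A) B l fS fW.
rewrite !inE negb_or lC lA lB (finset.setUCA C) -!finset.setUA.
have -> : [disjoint C :|: A & B] by rewrite disjointsU dAB dCB.
have -> : [disjoint A & (l |: B)].
  by rewrite disjoint_sym disjointsU finset.disjoints1 lA disjoint_sym.
have -> : [disjoint C & (l |: B)].
  by rewrite disjoint_sym disjointsU finset.disjoints1 lC disjoint_sym.
by rewrite dCA; move=> /(_ isT isT isT) ? /(_ isT isT isT); lra.
Qed.

End SetFunctions.

Section Pippenger.
Variables (R : realType) (n : nat) (s : 'cV[R]_(edim n)).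

Lemma elemental_locally_submodular :
  lemx 0 (G n R *m s) -> locally_submodular (ent s).
Proof.
(* The local inequality is symmetric in [i] and [j], while the elemental family lists each pair
   once, with [i < j]. *)
move=> /mulG_ge0[e1 _] K i j; wlog ltij : i j / (i < j)%N.
  move=> wl iK jK ij; have [lij|lji] := ltnP i j; first exact: wl.
  rewrite finset.setUCA addrC [leRHS]addrC addrC; apply: wl => //; last by rewrite eq_sym.
  by rewrite ltn_neqAle lji andbT eq_sym.
move=> iK jK ij; have := e1 (i |: K) (j |: K).
rewrite -finset.setUIl -finset.setUUl finset.setUA .
have IJ : (i |: K, j |: K) \in elemental1 n.
  rewrite inE; apply/existsP; exists i; apply/existsP; exists j.
  rewrite ltij andbT /=; apply/andP; split; apply/eqP/finset.setP => x; rewrite !inE.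
    by have [->|] := eqVneq x i; [rewrite (negbTE ij) iK | case: (x \in K); rewrite ?orbT ?andbF].
  by have [->|] := eqVneq x j; [rewrite eq_sym (negbTE ij) jK | case: (x \in K); rewrite ?orbT ?andbF].
move=> /(_ IJ); rewrite (_ : [set i] :&: [set j] = finset.set0) ?finset.set0U; first by lra.
by apply/eqP; rewrite finset.setI_eq0 finset.disjoints1 inE.
Qed.

Lemma elemental_pure_weakly_monotone :
  lemx 0 (G n R *m s) -> pure_weakly_monotone (ent s).
Proof.
(* The sets [l |: A] and [l |: B] cover all parties, so one of them contains [ordS l]; exchanging
   [A] and [B] makes it the first. For [n = 1], [ordS l] is [l] itself. *)
move=> /mulG_ge0[_ e2] A B l; wlog lS : A B / ordS l \in (l |: A).
  move=> wl lA lB dAB AB.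
  have : ordS l \in (l |: (A :|: B)) by rewrite AB inE.
  rewrite finset.setUA inE => /orP[lS|lS]; first exact: wl.
  rewrite addrC [leRHS]addrC; apply: wl => //; first by rewrite inE lS orbT.
    by rewrite disjoint_sym.
  by rewrite (finset.setUC B).
move=> lA lB dAB AB; have := e2 (l |: A) (l |: B).
have D (X Y : {set 'I_n}) : l \notin X -> [disjoint X & Y] ->
    (l |: X) :\: (l |: Y) = X.
  move=> lX dXY; apply/finset.setP => x; rewrite !inE.
  have [->|_] := eqVneq x l; first by rewrite (negbTE lX).
  by case xX : (x \in X); rewrite ?andbF // (disjointFr dXY).
have IJ : (l |: A, l |: B) \in elemental2 n.
  rewrite inE; apply/existsP; exists l; rewrite /= lS -finset.setUIr -finset.setUUr AB.
  by rewrite (disjoint_setI0 dAB) finset.setU0 !eqxx.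
by move=> /(_ IJ); rewrite !D // 1?disjoint_sym //; lra.
Qed.

Theorem elemental_von_Neumann_cone :
  lemx 0 (G n R *m s) <-> von_Neumann_cone s.
Proof.
split=> [Gs I J _ _|sC].
  have fS := locally_submodular_submodular (elemental_locally_submodular Gs).
  by split; [exact: fS|exact: weakly_monotone (elemental_pure_weakly_monotone Gs)].
(* Elemental inequalities are basic instances once both sets are nonempty: [i] and [j], or the
   common point [l], witness this. *)
apply/mulG_ge0; split=> I J; rewrite inE.
  case/existsP=> i /existsP[j /and3P[/= /eqP Ii /eqP Jj _]].
  have [||+ _] := sC I J; last by rewrite /strong_subadditivity; lra.
    by apply/set0Pn; exists i; have := finset.set11 i; rewrite -Ii inE => /andP[].
  by apply/set0Pn; exists j; have := finset.set11 j; rewrite -Jj inE => /andP[].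
case/existsP=> l /and3P[/= /eqP IJ _ _].
have [lI lJ] : l \in I /\ l \in J.
  by apply/andP; rewrite -finset.in_setI IJ finset.set11.
have [||_] := sC I J; last by rewrite /weak_monotonicity; lra.
  by apply/set0Pn; exists l.
by apply/set0Pn; exists l.
Qed.

End Pippenger.

Local Open Scope classical_set_scope.
Local Open Scope ring_scope.

Theorem mainTheorem1 (R : realType) (n : nat) (hn : (1 <= n)%N)
    (b : 'cV[R]_(edim n)) :
  von_Neumann_type b <->
  is_min [set inner b s | s in [set s : 'cV[R]_(edim n) | lemx 0 (G n R *m s)]] 0.
Proof.
split=> [bC|[_ b0] s /elemental_von_Neumann_cone Gs]; last by apply: b0; exists s.
(* The zero vector is feasible and attains the value zero. *)
split; first by exists 0; rewrite /inner ?mulmx0 ?mxE //= => i j; rewrite mulmx0.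
by move=> _ [s /elemental_von_Neumann_cone sC <-]; exact: bC.
Qed.
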